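(* Let $A$ be an $n\times m$ $0,1$-matrix and $B$ a $p\times q$ $0,1$-matrix. Suppose that there exist two families of $0,1$-matrices, $\mathcal{M}=\{M_1,\ldots,M_s\}$ (each of size $n\times m$) and $\mathcal{N}=\{N_1,\ldots,N_s\}$ (each of size $p\times q$), such that (1) $\mathcal{M}$ is a cover of $A$, and (2) for every $i,j$ such that $A_{i,j}=1$, the matrices $N_t$ for which $(M_t)_{i,j}=1$ form a cover of $B$. Then $\mathrm{R}_{\mathbb{B}}(A\otimes B)\le \sum_{t=1}^{s}\mathrm{R}_{\mathbb{B}}(M_t)\cdot \mathrm{R}_{\mathbb{B}}(N_t)$.
   Context: The Boolean rank $\mathrm{R}_{\mathbb{B}}(A)$ of a $0,1$-matrix $A$ is the smallest number of combinatorial rectangles $X\times Y$ (sets of row indices times sets of column indices) with all entries of $A$ in them equal to $1$, needed to cover all $1$-entries of $A$; equivalently, the smallest $k$ with $A=UV$ for $0,1$-matrices $U,V$ of inner dimension $k$ under Boolean arithmetic ($1+1=1$). The zero matrix has Boolean rank $0$. A collection $\{M_1,\ldots,M_s\}$ of $0,1$-matrices of the same size as $A$ is a cover of $A$ if for every $i,j$: $A_{i,j}=1$ if and only if $(M_t)_{i,j}=1$ for some $t$ (i.e. $A$ is their Boolean sum). The Kronecker product $A\otimes B$ is the block matrix whose $(i,j)$-th block is $A_{i,j}\cdot B$. *)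

(* Defs.v *)
From mathcomp Require Export all_boot all_order all_algebra.
From mathcomp.real_closed Require Export mxtens.

Set Implicit Arguments.
Unset Strict Implicit.
Unset Printing Implicit Defensive.

(* A 0,1-matrix is an 'M[bool]_(n, m), with true standing for 1.  The product
   of the ring structure on bool is andb, so the library's Kronecker product
   tensmx is the intended one; its addition is xor and is never used here. *)

Section BooleanRank.

Variables n m : nat.
Implicit Types (A : 'M[bool]_(n, m)) (R : {set 'I_n} * {set 'I_m}).
Implicit Type F : {set {set 'I_n} * {set 'I_m}}.

Definition ones_rect A R : bool :=
  [forall i in R.1, forall j in R.2, A i j].

Definition rect_cover A F : bool :=
  [forall R in F, ones_rect A R] &&
  [forall i, forall j,
    A i j ==> [exists R in F, (i \in R.1) && (j \in R.2)]].

Lemma ex_rect_cover A : exists k, [exists F, rect_cover A F && (#|F| == k)].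
Proof.
pose F := [set R | ones_rect A R].
exists #|F|; apply/existsP; exists F; rewrite eqxx andbT; apply/andP; split.
  by apply/forall_inP => R; rewrite inE.
apply/forallP => i; apply/forallP => j; apply/implyP => Aij.
apply/exists_inP; exists ([set i], [set j]); last by rewrite !set11.
rewrite inE; apply/forall_inP => i' /set1P ->.
by apply/forall_inP => j' /set1P ->.
Qed.

Definition boolean_rank A : nat := ex_minn (ex_rect_cover A).

Definition is_cover (C : {set 'M[bool]_(n, m)}) A : Prop :=
  forall i j, A i j <-> exists2 M, M \in C & M i j.

End BooleanRank.

Lemma boolean_rank0 n m : boolean_rank (const_mx false : 'M[bool]_(n, m)) = 0.
Proof.
rewrite /boolean_rank; case: ex_minnP => k _ /(_ 0) H; apply/eqP.
rewrite -leqn0; apply: H; apply/existsP; exists set0; rewrite cards0 eqxx andbT.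
apply/andP; split; first by apply/forall_inP => R; rewrite inE.
by apply/forallP => i; apply/forallP => j; rewrite mxE.
Qed.

(* Main.v *)
Require Import Defs.

Set Implicit Arguments.
Unset Strict Implicit.
Unset Printing Implicit Defensive.

(** Boolean rank is subadditive under Boolean sums and submultiplicative under
    Kronecker products, since a product of rectangles is a rectangle. The two
    covering hypotheses say exactly that [tensmx A B] is the Boolean sum of the
    matrices [tensmx (M t) (N t)]. *)

Section RectCover.

Variables n m : nat.
Implicit Types (A : 'M[bool]_(n, m)) (R : {set 'I_n} * {set 'I_m}).
Implicit Type F : {set {set 'I_n} * {set 'I_m}}.

Lemma ones_rectP A R :
  reflect (forall i j, i \in R.1 -> j \in R.2 -> A i j) (ones_rect A R).
Proof.
apply: (iffP forall_inP) => [AR i j Ri Rj | AR i Ri].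
  by have /forall_inP := AR i Ri; apply.
by apply/forall_inP => j; apply: AR.
Qed.

Lemma rect_coverP A F :
  reflect ((forall R, R \in F -> ones_rect A R) /\
           (forall i j, A i j -> exists2 R, R \in F & (i \in R.1) && (j \in R.2)))
          (rect_cover A F).
Proof.
apply: (iffP andP) => -[FA covA]; split.
- exact/forall_inP.
- by move=> i j Aij; move/forallP/(_ i)/forallP/(_ j): covA;
    rewrite Aij => /exists_inP.
- exact/forall_inP.
by apply/forallP => i; apply/forallP => j; apply/implyP => /covA/exists_inP.
Qed.

Lemma boolean_rank_le A F : rect_cover A F -> boolean_rank A <= #|F|.
Proof.
move=> covF; rewrite /boolean_rank; case: ex_minnP => k _; apply.
by apply/existsP; exists F; rewrite covF eqxx.
Qed.

Lemma boolean_rank_attained A :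
  exists F, rect_cover A F && (#|F| == boolean_rank A).
Proof. by rewrite /boolean_rank; case: ex_minnP => k /existsP. Qed.

(** A rectangle of ones of some [P t] is also one of [A], so the union of minimum covers of all the
    [P t] covers [A]; its size is at most the sum of theirs. *)
Lemma boolean_rank_sum (I : finType) A (P : I -> 'M[bool]_(n, m)) :
  (forall i j, A i j <-> exists t, P t i j) ->
  boolean_rank A <= \sum_t boolean_rank (P t).
Proof.
(* [xchoose] turns the existence of a minimum cover for each [t] into a function [F] of [t], whose
   union can then be formed. *)
move=> AP; have F_ t := xchooseP (boolean_rank_attained (P t)).
pose F t := xchoose (boolean_rank_attained (P t)).
have {}F_ t : rect_cover (P t) (F t) /\ #|F t| = boolean_rank (P t).
  by have /andP[? /eqP] := F_ t.
apply: (@leq_trans #|\bigcup_t F t|).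
  apply: boolean_rank_le; apply/rect_coverP; split.
    move=> R /bigcupP[t _ FR]; apply/ones_rectP => i j Ri Rj.
    apply/AP; exists t; have [/rect_coverP[/(_ R FR) + _] _] := F_ t.
    by move/ones_rectP; apply.
  move=> i j /AP[t Pij]; have [/rect_coverP[_ /(_ i j Pij)[R FR Rij]] _] := F_ t.
  by exists R => //; apply/bigcupP; exists t.
apply: (@leq_trans (\sum_t #|F t|)); last first.
  by apply: leq_sum => t _; have [_ ->] := F_ t.
elim/big_rec2: _ => [|t k S _ leSk]; first by rewrite cards0.
by rewrite (leq_trans (leq_card_setU _ _)) ?leq_add2l.
Qed.

End RectCover.

Lemma tensmx_boolE (n m p q : nat) (A : 'M[bool]_(n, m)) (B : 'M[bool]_(p, q))
    i j :
  tensmx A B i j = A (mxtens_unindex i).1 (mxtens_unindex j).1 &&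
                   B (mxtens_unindex i).2 (mxtens_unindex j).2.
Proof. by rewrite mxE. Qed.

(** The product of [X] and [Y], carried into ['I_(n * p)] by the same index bijection that [tensmx]
    uses for its rows and columns. *)
Definition tens_set (n p : nat) (X : {set 'I_n}) (Y : {set 'I_p}) :
    {set 'I_(n * p)} :=
  [set x | ((mxtens_unindex x).1 \in X) && ((mxtens_unindex x).2 \in Y)].

(** An entry of [tensmx A B] is a conjunction of an entry of [A] and one of [B], so pairing the
    rectangles of two minimum covers yields a cover of it. *)
Lemma boolean_rank_tensmx (n m p q : nat)
    (A : 'M[bool]_(n, m)) (B : 'M[bool]_(p, q)) :
  boolean_rank (tensmx A B) <= boolean_rank A * boolean_rank B.
Proof.
have [F /andP[/rect_coverP[FA covA] /eqP <-]] := boolean_rank_attained A.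
have [G /andP[/rect_coverP[GB covB] /eqP <-]] := boolean_rank_attained B.
pose h (RS : ({set 'I_n} * {set 'I_m}) * ({set 'I_p} * {set 'I_q})) :=
  (tens_set RS.1.1 RS.2.1, tens_set RS.1.2 RS.2.2).
(* [h] may identify pairs whose rectangles have empty sides, but an image is never larger than its
   source. *)
rewrite -cardsX; apply: leq_trans (leq_imset_card h _).
apply: boolean_rank_le; apply/rect_coverP; split.
  move=> _ /imsetP[[R S] /setXP[FR GS] ->]; apply/ones_rectP => i j /=.
  rewrite !inE tensmx_boolE => /andP[Ri Si] /andP[Rj Sj]; apply/andP; split.
    exact: (elimT (ones_rectP _ _) (FA R FR)).
  exact: (elimT (ones_rectP _ _) (GB S GS)).
move=> i j; rewrite tensmx_boolE => /andP[/covA[R FR /andP[Ri Rj]]].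
move=> /covB[S GS /andP[Si Sj]]; exists (h (R, S)).
  by apply: imset_f; apply/setXP.
by rewrite !inE Ri Rj Si Sj.
Qed.

Theorem theorem1 (n m p q s : nat)
    (A : 'M[bool]_(n, m)) (B : 'M[bool]_(p, q))
    (M : 'I_s -> 'M[bool]_(n, m)) (N : 'I_s -> 'M[bool]_(p, q))
    (M_cover : is_cover [set M t | t : 'I_s] A)
    (N_cover : forall (i : 'I_n) (j : 'I_m), A i j ->
       is_cover [set N t | t : 'I_s & M t i j] B) :
  boolean_rank (tensmx A B) <=
    \sum_(t < s) boolean_rank (M t) * boolean_rank (N t).
Proof.
apply: (@leq_trans (\sum_(t < s) boolean_rank (tensmx (M t) (N t)))); last first.
  by apply: leq_sum => t _; apply: boolean_rank_tensmx.
apply: boolean_rank_sum => x y; rewrite tensmx_boolE.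
set i := (mxtens_unindex x).1; set j := (mxtens_unindex y).1.
(* The index [t] must serve both factors at once: the cover of [B] attached to this [(i, j)]
   contains [N t] only for [t] with [M t i j]. *)
split=> [/andP[Aij /(N_cover _ _ Aij)[_ /imsetP[t + ->] Nt]] | [t]].
  by rewrite inE => Mt; exists t; rewrite tensmx_boolE Mt.
rewrite tensmx_boolE => /andP[Mt Nt].
(* [M t i j] forces [A i j], and this is what makes [N_cover] available at [(i, j)]. *)
have Aij : A i j by apply/M_cover; exists (M t) => //; apply: imset_f.
rewrite Aij; apply/(N_cover _ _ Aij); exists (N t) => //.
by apply: imset_f; rewrite inE.
Qed.
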